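(* The Burckel normal form coincides with the $\Phi$-normal form: for every $n\ge2$ and every positive $n$-strand braid $x\in B_n^+$, the unique Burckel normal word representing $x$ is equal to the $\Phi$-normal form of $x$.
   Context: $B_n^+$ is the monoid generated by $\sigma_1,\ldots,\sigma_{n-1}$ with relations $\sigma_i\sigma_j=\sigma_j\sigma_i$ for $|i-j|\ge2$ and $\sigma_i\sigma_j\sigma_i=\sigma_j\sigma_i\sigma_j$ for $|i-j|=1$; $B_{n-1}^+$ is the submonoid generated by $\sigma_1,\ldots,\sigma_{n-2}$. $\underline{B}_n^+$ is the free monoid of words on $\{\sigma_1,\ldots,\sigma_{n-1}\}$; $w\equiv w'$ means that $w,w'$ represent the same element of $B_n^+$. $\Phi_n$ maps $\sigma_i$ to $\sigma_{n-i}$; it acts as an automorphism of $B_n^+$ and, letterwise, on words. $n$-splitting of a braid ($n\ge3$): every $x\in B_n^+$ admits a unique decomposition $x=\Phi_n^{p-1}(x_p)\cdots\Phi_n(x_2)\,x_1$ with $p\ge1$ and all $x_r\in B_{n-1}^+$ such that, for $2\le r\le p$, $\sigma_1$ is the only $\sigma_i$ that is a right divisor of $\Phi_n^{p-r}(x_p)\cdots\Phi_n(x_{r+1})\,x_r$ (where $y$ is a right divisor of $x$ if $x=zy$ for some $z$ in $B_n^+$); the $n$-splitting of $x$ is $(x_p,\ldots,x_1)$. $\Phi$-normal form: for $x=\sigma_1^e\in B_2^+$ it is the word $\sigma_1^e$; for $n\ge3$ and $x\in B_n^+$ with $n$-splitting $(x_p,\ldots,x_1)$, it is the word $\Phi_n^{p-1}(w_p)\cdots\Phi_n(w_2)\,w_1$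 where $w_r$ is the $\Phi$-normal form of $x_r\in B_{n-1}^+$. (It does not depend on the $n$ for which $x$ is viewed in $B_n^+$.) $n$-splitting of a word ($n\ge3$): for $w\in\underline{B}_n^+$ it is the sequence $(w_p,\ldots,w_1)$ of words of $\underline{B}_{n-1}^+$ obtained as follows: put $w^{(0)}=w$; $w_r$ is the longest suffix of $w^{(r-1)}$ not containing $\sigma_{n-1}$, and $w^{(r)}$ is obtained by removing this suffix from $w^{(r-1)}$ and applying $\Phi_n$; stop at the first $p\ge1$ for which $w^{(p)}$ is empty. Thus $w=\Phi_n^{p-1}(w_p)\cdots\Phi_n(w_2)w_1$. Exponent sequence: for $w\in\underline{B}_n^+$ define $\underline{D}_n^*(w)$ by $\underline{D}_2^*(\sigma_1^e)=e\in\mathbb{N}$ and, for $n\ge3$, $\underline{D}_n^*(w)=(\underline{D}_{n-1}^*(w_p),\ldots,\underline{D}_{n-1}^*(w_1))$ where $(w_p,\ldots,w_1)$ is the $n$-splitting of $w$. This is an $(n-2)$-sequence of natural numbers, where a $0$-sequence is a natural number and a $k$-sequence is a finite sequence of $(k-1)$-sequences. ShortLex-ordering of $k$-sequences of natural numbers: for $k=0$ it is the usual order of $\mathbb{N}$; for $k\ge1$, $(s_p,\ldots,s_1)$ is smaller than $(t_q,\ldots,t_1)$ if $p<q$, or $p=q$ and there is $r\le p$ with $s_{r'}=t_{r'}$ for $p\ge r'>r$ and $s_r$ ShortLex-smaller than $t_r$. A word $w\in\underline{B}_n^+$ is Burckel normal if $\underline{D}_n^*(w)$ is ShortLex-minimal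 among all $\underline{D}_n^*(w')$ with $w'\equiv w$; each positive braid has a unique Burckel normal representative, called its Burckel normal form. *)

(* Defs.v *)
From HB Require Import structures.
From mathcomp Require Import all_boot.
From mathcomp Require Import boolp zify.

Set Implicit Arguments.
Unset Strict Implicit.
Unset Printing Implicit Defensive.

Local Open Scope quotient_scope.

(* Words on sigma_1, ..., sigma_(n-1): the ordinal i of 'I_n.-1 stands for    *)
(* sigma_(i+1).                                                               *)
Definition word (n : nat) : Type := seq 'I_n.-1.

Section PositiveBraids.
Variable n : nat.

Inductive braid_relation : word n -> word n -> Prop :=
| braid_far (i j : 'I_n.-1) of (i.+2 <= j) || (j.+2 <= i) :
    braid_relation [:: i; j] [:: j; i]
| braid_near (i j : 'I_n.-1) of (j == i.+1 :> nat) || (i == j.+1 :> nat) :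
    braid_relation [:: i; j; i] [:: j; i; j].

Inductive braid_eq : word n -> word n -> Prop :=
| braid_eq_step (u v l r : word n) of braid_relation l r :
    braid_eq (u ++ l ++ v) (u ++ r ++ v)
| braid_eq_refl w : braid_eq w w
| braid_eq_sym w1 w2 of braid_eq w1 w2 : braid_eq w2 w1
| braid_eq_trans w1 w2 w3 of braid_eq w1 w2 & braid_eq w2 w3 : braid_eq w1 w3.

Definition braid_eqb : rel (word n) := fun w1 w2 => `[< braid_eq w1 w2 >].

Lemma braid_eqb_refl : reflexive braid_eqb.
Proof. by move=> w; apply/asboolP/braid_eq_refl. Qed.

Lemma braid_eqb_sym : symmetric braid_eqb.
Proof. by move=> w1 w2; apply/asboolP/asboolP; apply: braid_eq_sym. Qed.

Lemma braid_eqb_trans : transitive braid_eqb.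
Proof.
move=> w2 w1 w3 /asboolP h12 /asboolP h23.
by apply/asboolP; apply: braid_eq_trans h23.
Qed.

Canonical braid_equiv := EquivRel braid_eqb
  braid_eqb_refl braid_eqb_sym braid_eqb_trans.

(* The monoid B_n^+ *)
Definition braid : Type := {eq_quot braid_equiv}.

HB.instance Definition _ := Choice.on braid.
HB.instance Definition _ := EqQuotient.on braid.

Definition braid_of (w : word n) : braid := \pi_braid w.

Lemma braid_ofP w1 w2 : braid_of w1 = braid_of w2 <-> braid_eq w1 w2.
Proof.
split=> [/eqmodP/asboolP // | h].
by apply/eqmodP/asboolP.
Qed.

Lemma repr_braidK (x : braid) : braid_of (repr x) = x.
Proof. exact: reprK. Qed.

Definition braid_mul (x y : braid) : braid := braid_of (repr x ++ repr y).

Lemma braid_eq_catl u w1 w2 : braid_eq w1 w2 -> braid_eq (u ++ w1) (u ++ w2).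
Proof.
elim=> {w1 w2} [u' v l r h|w|w1 w2 _|w1 w2 w3 _ h12 _ h23].
- by rewrite !(catA u); apply: braid_eq_step.
- exact: braid_eq_refl.
- exact: braid_eq_sym.
- exact: braid_eq_trans h23.
Qed.

Lemma braid_eq_catr u w1 w2 : braid_eq w1 w2 -> braid_eq (w1 ++ u) (w2 ++ u).
Proof.
elim=> {w1 w2} [u' v l r h|w|w1 w2 _|w1 w2 w3 _ h12 _ h23].
- by rewrite -!catA; apply: braid_eq_step.
- exact: braid_eq_refl.
- exact: braid_eq_sym.
- exact: braid_eq_trans h23.
Qed.

Lemma braid_of_cat u v : braid_of (u ++ v) = braid_mul (braid_of u) (braid_of v).
Proof.
apply/braid_ofP/(@braid_eq_trans _ (repr (braid_of u) ++ v)).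
- by apply/braid_eq_catr/braid_ofP; rewrite repr_braidK.
- by apply/braid_eq_catl/braid_ofP; rewrite repr_braidK.
Qed.

Lemma braid_mulA : associative braid_mul.
Proof.
move=> x y z; rewrite -(repr_braidK x) -(repr_braidK y) -(repr_braidK z).
by rewrite -!braid_of_cat catA.
Qed.

Lemma braid_mul1 : left_id (braid_of [::]) braid_mul.
Proof. by move=> x; rewrite -(repr_braidK x) -braid_of_cat. Qed.

Lemma braid_mulr1 : right_id (braid_of [::]) braid_mul.
Proof. by move=> x; rewrite -(repr_braidK x) -braid_of_cat cats0. Qed.

HB.instance Definition _ :=
  isMonoid.Build braid braid_mulA braid_mul1 braid_mulr1.

Local Open Scope group_scope.

Definition sigma (i : 'I_n.-1) : braid := braid_of [:: i].

Definition right_divisor (y x : braid) : Prop := exists z : braid, x = z * y.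

(* Phi_n: the reversal of 'I_n.-1 sends sigma_i to sigma_(n-i). *)
Definition word_flip (w : word n) : word n := map (@rev_ord _) w.

Definition braid_flip (x : braid) : braid := braid_of (word_flip (repr x)).

Lemma braid_eq_flip w1 w2 :
  braid_eq w1 w2 -> braid_eq (word_flip w1) (word_flip w2).
Proof.
elim=> {w1 w2} [u v l r h|w|w1 w2 _|w1 w2 w3 _ h12 _ h23].
- rewrite /word_flip !map_cat; apply: braid_eq_step.
  case: h => i j hij /=; constructor; move: hij (ltn_ord i) (ltn_ord j) => /=;
    lia.
- exact: braid_eq_refl.
- exact: braid_eq_sym.
- exact: braid_eq_trans h23.
Qed.

Lemma braid_flip_of w : braid_flip (braid_of w) = braid_of (word_flip w).
Proof. by apply/braid_ofP/braid_eq_flip/braid_ofP; rewrite repr_braidK. Qed.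

End PositiveBraids.

(* The inclusion of B_n^+ in B_(n+1)^+ *)
Definition letter_incl n (i : 'I_n.-1) : 'I_n := widen_ord (leq_pred n) i.

Definition word_incl n (w : word n) : word n.+1 := map (@letter_incl n) w.

Definition braid_incl n (x : braid n) : braid n.+1 :=
  braid_of (word_incl (repr x)).

(* sigma_n has no preimage under the inclusion; every other letter does. *)
Definition letter_restr n (i : 'I_n) : option 'I_n.-1 := insub (i : nat).

Definition word_restr n (w : word n.+1) : word n := pmap (@letter_restr n) w.

Lemma letter_inclK n : pcancel (@letter_incl n) (@letter_restr n).
Proof. by move=> i; rewrite /letter_restr /= valK. Qed.

Lemma word_inclK n : cancel (@word_incl n) (@word_restr n).
Proof. by move=> w; apply/map_pK/letter_inclK. Qed.

Lemma braid_eq_incl n (w1 w2 : word n) :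
  braid_eq w1 w2 -> braid_eq (word_incl w1) (word_incl w2).
Proof.
elim=> {w1 w2} [u v l r h|w|w1 w2 _|w1 w2 w3 _ h12 _ h23].
- rewrite /word_incl !map_cat; apply: braid_eq_step.
  by case: h => i j hij /=; constructor.
- exact: braid_eq_refl.
- exact: braid_eq_sym.
- exact: braid_eq_trans h23.
Qed.

Lemma braid_incl_of n (w : word n) :
  braid_incl (braid_of w) = braid_of (word_incl w).
Proof. by apply/braid_ofP/braid_eq_incl/braid_ofP; rewrite repr_braidK. Qed.

(* In a word of n+1 strands, the top letter is sigma_n. *)
Definition is_top n (i : 'I_n) : bool := i == n.-1 :> nat.

Definition no_top n (w : word n.+1) : bool := all (predC (@is_top n)) w.

Lemma is_topE n (i : 'I_n) : is_top i = ~~ (i < n.-1).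
Proof. by rewrite /is_top; have := ltn_ord i; lia. Qed.

Lemma no_top_incl n (w : word n) : no_top (word_incl w).
Proof. by rewrite /no_top all_map; apply/allP=> i _ /=; rewrite is_topE negbK /=. Qed.

Lemma braid_eq_restr n (w1 w2 : word n.+1) : braid_eq w1 w2 ->
  no_top w1 = no_top w2 /\
  (no_top w1 -> braid_eq (word_restr w1) (word_restr w2)).
Proof.
elim=> {w1 w2} [u v l r h|w|w1 w2 _ [-> h]|w1 w2 w3 _ [-> h12] _ [e h23]].
- have e : no_top l = no_top r.
    by case: h => i j _; rewrite /no_top /=; do 2?case: is_top.
  rewrite /no_top !all_cat -!/(no_top _) e; split=> // /and3P[_ hr _].
  rewrite /word_restr !pmap_cat; apply: braid_eq_step.
  case: h hr {e} => i j hij; rewrite /no_top /= !is_topE !negbK /letter_restr.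
  + case/and3P=> hj hi _; rewrite !insubT /=.
    exact: braid_far.
  + case/and4P=> hj hi _ _; rewrite !insubT /=.
    exact: braid_near.
- by split=> // _; exact: braid_eq_refl.
- by split=> // /h; exact: braid_eq_sym.
- by split=> // h; exact: braid_eq_trans (h12 h) (h23 h).
Qed.

Lemma braid_incl_inj n : injective (@braid_incl n).
Proof.
move=> x y h; have {}h := proj1 (braid_ofP _ _) h.
have [_ {}h] := braid_eq_restr h.
move: (h (no_top_incl _)); rewrite !word_inclK => {}h.
by rewrite -(repr_braidK x) -(repr_braidK y); apply/braid_ofP.
Qed.

(* Sequences are listed as in (x_p, ..., x_1): the head of s is x_p, so it is *)
(* the element x_r that sits at position size s - r.                          *)
Fixpoint braid_alt n (s : seq (braid n)) : braid n.+1 :=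
  if s is x :: s' then
    (iter (size s') (@braid_flip n.+1) (braid_incl x) * braid_alt s')%g
  else 1%g.

Fixpoint word_alt n (s : seq (word n)) : word n.+1 :=
  if s is w :: s' then
    iter (size s') (@word_flip n.+1) (word_incl w) ++ word_alt s'
  else [::].

(* The (n+1)-splitting of x; the list take (p - r).+1 s is (x_p, ..., x_r).   *)
Definition braid_splitting n (x : braid n.+1) (s : seq (braid n)) : Prop :=
  let p := size s in
  [/\ 0 < p, x = braid_alt s &
    forall r, 2 <= r <= p -> forall i : 'I_n,
      right_divisor (sigma (n := n.+1) i) (braid_alt (take (p - r).+1 s)) <->
      i = 0 :> nat].

(* One step of the recursion: NF is the relation between the elements of      *)
(* B_n^+ and their Phi-normal forms, and the result is that for B_(n+1)^+.    *)
Definition Phi_normal_form_step n (NF : braid n -> word n -> Prop)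
    (x : braid n.+1) (w : word n.+1) : Prop :=
  exists (xs : seq (braid n)) (ws : seq (word n)),
    [/\ braid_splitting x xs, List.Forall2 NF xs ws & w = word_alt ws].

Definition Phi_normal_form2 (x : braid 2) (w : word 2) : Prop :=
  exists e : nat, x = (sigma (n := 2) ord0 ^+ e)%g /\ w = nseq e ord0.

(* Phi_normal_form x w: w is the Phi-normal form of x. The values for n < 2,  *)
(* where there are no letters, are conventional.                              *)
Fixpoint Phi_normal_form n : braid n -> word n -> Prop :=
  match n return braid n -> word n -> Prop with
  | 0 => fun _ w => w = [::]
  | k.+1 =>
    match k return (braid k -> word k -> Prop) ->
                   braid k.+1 -> word k.+1 -> Prop with
    | 0 => fun _ _ w => w = [::]
    | 1 => fun _ => Phi_normal_form2
    | m.+2 => fun NF => Phi_normal_form_step NF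
    end (@Phi_normal_form k)
  end.

Definition suffix_length n (w : word n.+1) : nat := find (@is_top n) (rev w).

Definition word_tail n (w : word n.+1) : word n.+1 :=
  drop (size w - suffix_length w) w.

Definition word_head n (w : word n.+1) : word n.+1 :=
  take (size w - suffix_length w) w.

(* The fuel (size w).+1 is enough for n >= 2: word_splittingE below is the    *)
(* recursion without fuel.                                                    *)
Fixpoint word_splitting_rec n (fuel : nat) (w : word n.+1) : seq (word n) :=
  if fuel is fuel'.+1 then
    if nilp (word_head w) then [:: word_restr (word_tail w)]
    else rcons (word_splitting_rec fuel' (word_flip (word_head w)))
               (word_restr (word_tail w))
  else [::].

(* The (n+1)-splitting of w, for n >= 2 *)
Definition word_splitting n (w : word n.+1) : seq (word n) :=
  word_splitting_rec (size w).+1 w.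

Lemma word_cat_head_tail n (w : word n.+1) : word_head w ++ word_tail w = w.
Proof. exact: cat_take_drop. Qed.

Lemma no_top_tail n (w : word n.+1) : no_top (word_tail w).
Proof.
rewrite /no_top /word_tail /suffix_length -[w in drop _ w]revK -(size_rev w).
by rewrite -rev_take all_rev; elim: (rev w) => //= i v; case: ifP => //= ->.
Qed.

Lemma head_ends_top n (w : word n.+1) : ~~ nilp (word_head w) ->
  exists (v : word n.+1) (i : 'I_n), word_head w = rcons v i /\ is_top i.
Proof.
rewrite /word_head /suffix_length -[w in take _ w]revK -(size_rev w).
rewrite -rev_drop; elim: (rev w) => //= i v IH; case: ifP => //= hi _.
by exists (rev v), i; rewrite rev_cons.
Qed.

Lemma size_word_flip n (w : word n) : size (word_flip w) = size w.
Proof. exact: size_map. Qed.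

Lemma suffix_length_flip n (w : word n.+1) : 2 <= n -> ~~ nilp (word_head w) ->
  0 < suffix_length (word_flip (word_head w)).
Proof.
move=> n2 /head_ends_top[v [i [-> hi]]].
rewrite /suffix_length /word_flip map_rcons rev_rcons /= /is_top /=.
by move: hi; rewrite /is_top => /eqP ->; case: ifP => //; lia.
Qed.

Lemma size_word_head n (w : word n.+1) :
  size (word_head w) = size w - suffix_length w.
Proof. by rewrite size_takel // leq_subr. Qed.

Lemma word_splitting_fuel n (f g : nat) (w : word n.+1) : 2 <= n ->
  0 < f -> size w + (suffix_length w == 0) <= f ->
  0 < g -> size w + (suffix_length w == 0) <= g ->
  word_splitting_rec f w = word_splitting_rec g w.
Proof.
move=> n2; elim: f g w => // f IH [//|g] w _ hf _ hg /=.
case: ifP => // /negbT hw; congr rcons.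
have hpos := suffix_length_flip n2 hw.
have hs := size_word_head w.
have hw0 : 0 < size (word_head w) by rewrite lt0n.
by apply: IH; rewrite ?size_word_flip; lia.
Qed.

Lemma word_splittingE n (w : word n.+1) : 2 <= n ->
  word_splitting w =
    if nilp (word_head w) then [:: word_restr (word_tail w)]
    else rcons (word_splitting (word_flip (word_head w)))
               (word_restr (word_tail w)).
Proof.
move=> n2; rewrite {1}/word_splitting /=; case: ifP => // /negbT hw.
congr rcons; have hpos := suffix_length_flip n2 hw.
have hs := size_word_head w.
have hw0 : 0 < size (word_head w) by rewrite lt0n.
have hle : size (word_head w) <= size w by rewrite hs leq_subr.
apply: word_splitting_fuel; rewrite ?size_word_flip ?eqn0Ngt ?hpos ?addn0 //.
exact: leq_trans hw0 hle.
Qed.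

Lemma word_flip_cat n (u v : word n) :
  word_flip (u ++ v) = word_flip u ++ word_flip v.
Proof. exact: map_cat. Qed.

Lemma word_flipK n : involutive (@word_flip n).
Proof. by apply: mapK; apply: rev_ordK. Qed.

Lemma word_alt_rcons n (s : seq (word n)) (w : word n) :
  word_alt (rcons s w) = word_flip (word_alt s) ++ word_incl w.
Proof.
elim: s => [|v s IH] /=; first by rewrite cats0.
by rewrite size_rcons IH iterS word_flip_cat catA.
Qed.

Lemma word_restrK n (w : word n.+1) : no_top w -> word_incl (word_restr w) = w.
Proof.
elim: w => //= i w IH; rewrite /no_top /= is_topE negbK => /andP[hi hw].
rewrite /letter_restr insubT /= -[in RHS](IH hw); congr cons; exact: val_inj.
Qed.

Lemma word_splittingK n (w : word n.+1) : 2 <= n ->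
  word_alt (word_splitting w) = w.
Proof.
move=> n2; rewrite /word_splitting; set f := (size w).+1.
have f0 : 0 < f by [].
have : size w + (suffix_length w == 0) <= f.
  by rewrite /f; case: (suffix_length w == 0); rewrite ?addn1 ?addn0.
clearbody f; elim: f w f0 => // f IH w _ hf /=; have := word_cat_head_tail w.
case: ifP => [/nilP -> /= wE|/negbT hw wE].
  by rewrite cats0 word_restrK ?no_top_tail.
have hpos := suffix_length_flip n2 hw.
have hs := size_word_head w.
have hw0 : 0 < size (word_head w) by rewrite lt0n.
have hle : size (word_head w) <= f by lia.
rewrite word_alt_rcons IH ?size_word_flip ?eqn0Ngt ?hpos ?addn0 //.
  by rewrite word_flipK word_restrK ?no_top_tail.
exact: leq_trans hw0 hle.
Qed.

Fixpoint nat_seq (k : nat) : Type :=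
  if k is k'.+1 then seq (nat_seq k') else nat.

(* The values for n < 2 are conventional. *)
Fixpoint exponent_sequence n : word n -> nat_seq n.-2 :=
  match n return word n -> nat_seq n.-2 with
  | 0 => fun _ => 0
  | k.+1 =>
    match k return (word k -> nat_seq k.-2) -> word k.+1 -> nat_seq k.-1 with
    | 0 => fun _ _ => 0
    | 1 => fun _ w => size w
    | m.+2 => fun D w => map D (word_splitting w)
    end (@exponent_sequence k)
  end.

Fixpoint shortlex (k : nat) : nat_seq k -> nat_seq k -> Prop :=
  match k return nat_seq k -> nat_seq k -> Prop with
  | k'.+1 => fun s t =>
      size s < size t \/
      size s = size t /\
      exists u a b s' t',
        [/\ s = u ++ a :: s', t = u ++ b :: t' & shortlex a b]
  | 0 => fun a b => a < b
  end.

Definition Burckel_normal n (w : word n) : Prop :=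
  forall w' : word n, braid_of w' = braid_of w ->
    ~ shortlex (exponent_sequence w') (exponent_sequence w).

Definition Burckel_normal_form n (x : braid n) (w : word n) : Prop :=
  braid_of w = x /\ Burckel_normal w.

(* Main.v *)
Require Import Defs.
From mathcomp Require Import all_boot.
From mathcomp Require Import boolp zify.

(* The exponent sequence compares words through the sequence of words of      *)
(* their splitting, so one may work with arbitrary alternating decompositions *)
(* of a braid into words on one strand less. The key fact (decreasing) is     *)
(* that every word for x sigma_i can be replaced by a smaller one for x u,    *)
(* for any u in <sigma_1, ..., sigma_(i-1)>. Given it, a minimal              *)
(* decomposition is the splitting of the braid: otherwise some entry but the  *)
(* last one could lose a right divisor to the next entry and get smaller.     *)
(*   The key fact is proved by induction on n and on the decomposition. Write *)
(* x sigma_i = Phi(y) w with w the last entry. If i is not maximal, then      *)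
(* either sigma_i can be removed from w, or y is right divisible by some      *)
(* sigma_j with j > 1 and one can decrease first. If i is maximal, Garside's  *)
(* lemma on left lcms shows that Phi(y) = z sigma_k ... sigma_(n-1) and       *)
(* x = z q r with q in <sigma_(k+1), ..., sigma_(n-1)> and r in the           *)
(* submonoid on one strand less; hence y = Phi(z) sigma_(n-k) ... sigma_1     *)
(* can be replaced by the smaller Phi(z) Phi(q), and w by r u.                *)

Set Implicit Arguments.
Unset Strict Implicit.
Unset Printing Implicit Defensive.

Local Open Scope group_scope.

(** Everything reduces to one implication: a Burckel normal word is the $\Phi$-normal form of its
    braid ([Burckel_Phi]). Burckel normal words exist because ShortLex is well founded
    ([shortlex_min]), and $\Phi$-normal forms are unique because splittings are
    ([splitting_unique]); so existence and uniqueness hold for both notions at once. For the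
    implication, take a sequence of words that is ShortLex-minimal among all sequences with the same
    alternating product. The product of a proper prefix is nontrivial, or the prefix could be
    dropped, and no $\sigma_j$ with $j\ge2$ divides it on the right: [decreasing_seq] would delete
    that factor, and its flip could be absorbed by the next entry, whose growth does not matter once
    the prefix has decreased. Hence the sequence is the splitting of the braid. Its entries are
    again Burckel normal, and induction on the number of strands applies. The algebra rests on
    [garside], which gives cancellation, closure of parabolic submonoids under lcms ([gen_lcm]), and
    the analysis of the top generator ([ladder_divides]). In the code the index 0 stands for
    $\sigma_1$. *)

(** * Right cancellation and left lcms of two generators *)

Section Garside.
Variable n : nat.
Implicit Types (u v w : word n) (x y z : braid n) (i j k : 'I_n.-1).

Definition far (i j : nat) := (i.+2 <= j) || (j.+2 <= i).
Definition near (i j : nat) := (j == i.+1) || (i == j.+1).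

Lemma braid_ind (P : braid n -> Prop) : (forall w, P (braid_of w)) ->
  forall x, P x.
Proof. by move=> h x; rewrite -(repr_braidK x). Qed.

Lemma braid_ofM u v : braid_of (u ++ v) = braid_of u * braid_of v.
Proof. exact: braid_of_cat. Qed.

Lemma braid_of_nil : braid_of [::] = 1 :> braid n.
Proof. exact: erefl. Qed.

Lemma braid_of_rcons w i : braid_of (rcons w i) = braid_of w * sigma i.
Proof. by rewrite -cats1 braid_ofM. Qed.

Lemma braid_of_cons w i : braid_of (i :: w) = sigma i * braid_of w.
Proof. by rewrite -braid_ofM. Qed.

Lemma sigma_far i j : far i j -> sigma i * sigma j = sigma j * sigma i.
Proof.
move=> h; have /braid_ofP := braid_eq_step [::] [::] (braid_far h).
by rewrite /= !braid_of_cons braid_of_nil !mulg1.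
Qed.

Lemma sigma_near i j : near i j ->
  sigma i * sigma j * sigma i = sigma j * sigma i * sigma j.
Proof.
move=> h; have /braid_ofP := braid_eq_step [::] [::] (braid_near h).
by rewrite /= !braid_of_cons braid_of_nil !mulg1 !mulgA.
Qed.

Lemma mulg_sigma_far x i j :
  far i j -> x * sigma i * sigma j = x * sigma j * sigma i.
Proof. by move=> h; rewrite -!mulgA sigma_far. Qed.

Lemma mulg_sigma_near x i j : near i j ->
  x * sigma i * sigma j * sigma i = x * sigma j * sigma i * sigma j.
Proof. by move=> h; rewrite -!mulgA !(mulgA (sigma _)) sigma_near. Qed.

Lemma braid_eq_size u v : braid_eq u v -> size u = size v.
Proof.
elim=> {u v} [u v l r h|w|w1 w2 _|w1 w2 w3 _ -> _ ->] //.
by rewrite !size_cat; case: h.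
Qed.

Definition length x := size (repr x).

Lemma length_of w : length (braid_of w) = size w.
Proof. by apply/braid_eq_size/braid_ofP; rewrite repr_braidK. Qed.

Lemma lengthM x y : length (x * y) = length x + length y.
Proof.
move: x y; apply: braid_ind => u; apply: braid_ind => v.
by rewrite -braid_ofM !length_of size_cat.
Qed.

Lemma length_sigma i : length (sigma i) = 1%N.
Proof. by rewrite length_of. Qed.

Lemma length1 : length 1 = 0.
Proof. by rewrite -braid_of_nil length_of. Qed.

(** To be read as [x * sigma i = y * sigma j]: the two sides are a left multiple of the left lcm of
    the two generators. *)
Variant common_multiple x i y j : Prop :=
| CommonEq of i = j & x = y
| CommonFar z of far i j & x = z * sigma j & y = z * sigma i
| CommonNear z of near i j & x = z * sigma i * sigma j
    & y = z * sigma j * sigma i.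

Lemma common_multiple_sym x i y j :
  common_multiple x i y j -> common_multiple y j x i.
Proof.
case=> [-> ->|z h -> ->|z h -> ->]; first exact: CommonEq.
- by apply: (@CommonFar _ _ _ _ z) => //; rewrite /far orbC.
- by apply: (@CommonNear _ _ _ _ z) => //; rewrite /near orbC.
Qed.

Lemma common_multiple_id x i y : common_multiple x i y i -> x = y.
Proof. by case=> // z; rewrite /far /near; lia. Qed.

Lemma common_multiple_far x i y j : far i j -> common_multiple x i y j ->
  exists2 z, x = z * sigma j & y = z * sigma i.
Proof.
move=> h; case=> [E|z _ -> ->|z]; last by move: h; rewrite /far /near; lia.
  by move: h; rewrite E /far; lia.
by exists z.
Qed.

Lemma common_multiple_near x i y j : near i j -> common_multiple x i y j ->
  exists2 z, x = z * sigma i * sigma j & y = z * sigma j * sigma i.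
Proof.
move=> h; case=> [E|z|z _ -> ->]; first by move: h; rewrite E /near; lia.
  by move: h; rewrite /far /near; lia.
by exists z.
Qed.

Lemma index_cases i j : [\/ i = j, far i j | near i j].
Proof.
have [/val_inj ->|ne] := eqVneq (val i) (val j); first by constructor 1.
have [f|f] := boolP (far i j); [by constructor 2|constructor 3].
by move: f ne; rewrite /far /near /=; lia.
Qed.

Definition garside_at l := forall x i y j,
  length x = l -> x * sigma i = y * sigma j -> common_multiple x i y j.

Section Step.
Variable l : nat.
Hypothesis IH : forall l', l' < l -> garside_at l'.

Lemma garside_cancel x y i : length x < l -> x * sigma i = y * sigma i -> x = y.
Proof. by move=> hl /(IH hl (erefl _))/common_multiple_id. Qed.

Lemma garside_far x y i j :
  length x < l -> far i j -> x * sigma i = y * sigma j ->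
  exists2 z, x = z * sigma j & y = z * sigma i.
Proof. by move=> hl h /(IH hl (erefl _))/(common_multiple_far h). Qed.

Lemma garside_near x y i j :
  length x < l -> near i j -> x * sigma i = y * sigma j ->
  exists2 z, x = z * sigma i * sigma j & y = z * sigma j * sigma i.
Proof. by move=> hl h /(IH hl (erefl _))/(common_multiple_near h). Qed.

(** The middle braid [y] is factored in two ways; Garside's property at smaller lengths aligns the
    two factorizations. This mixed case of transitivity serves twice, the second time with its ends
    exchanged. *)
Lemma common_multiple_far_near x i y k z j : length y = l ->
  far i k -> near k j -> common_multiple x i y k -> common_multiple y k z j ->
  common_multiple x i z j.
Proof.
move=> hl hik hkj /(common_multiple_far hik)[a -> ya].
move=> /(common_multiple_near hkj)[b yb ->].
have := congr1 length ya; have := congr1 length yb.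
rewrite !lengthM !length_sigma hl => lb la; have e := etrans (esym ya) yb.
case: (index_cases i j) => hij.
- by move: hik hkj; rewrite hij /far /near; lia.
- have [|c ea eb] := garside_far _ hij e; first by lia.
  have := congr1 length ea; rewrite lengthM length_sigma => lc; rewrite ea.
  have [||d -> ->] := @garside_far b c k i _ _ eb.
  + by lia.
  + by rewrite /far orbC.
  apply: (@CommonFar _ _ _ _ (d * sigma j * sigma k)) => //.
    by rewrite mulg_sigma_near.
  by rewrite (mulg_sigma_far _ hij) (mulg_sigma_far _ hik).
- have [|c ea eb] := garside_near _ hij e; first by lia.
  have := congr1 length ea; rewrite !lengthM !length_sigma => lc; rewrite ea.
  have [||d eb' ec] := @garside_far b (c * sigma j) k i _ _ eb.
  + by lia.
  + by rewrite /far orbC.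
  have [||f ef ed] := @garside_near c d j k _ _ ec.
  + by lia.
  + by rewrite /near orbC.
  rewrite eb' ed ef.
  apply: (@CommonNear _ _ _ _ (f * sigma i * sigma j * sigma k)) => //.
    rewrite -(mulg_sigma_far (f * sigma j) hik).
    rewrite (mulg_sigma_near (f * sigma j * sigma i) hkj).
    rewrite -(mulg_sigma_near f hij).
    by rewrite (mulg_sigma_far (f * sigma i * sigma j) hik).
  rewrite -(mulg_sigma_near (f * sigma k) hij) -(mulg_sigma_far f hik).
  rewrite (mulg_sigma_far (f * sigma i * sigma k * sigma j) hik).
  by rewrite (mulg_sigma_near (f * sigma i) hkj).
Qed.

Lemma common_multiple_trans x i y k z j : length y = l ->
  common_multiple x i y k -> common_multiple y k z j -> common_multiple x i z j.
Proof.
move=> hl h1 h2.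
have [ik|ik|ik] := index_cases i k.
- by subst k; rewrite (common_multiple_id h1).
- have [kj|kj|kj] := index_cases k j; last 1 first.
  + exact: common_multiple_far_near h1 h2.
  + by subst k; rewrite -(common_multiple_id h2).
  have [a -> ya] := common_multiple_far ik h1.
  have [b yb ->] := common_multiple_far kj h2.
  have := congr1 length ya; rewrite !lengthM !length_sigma hl => la.
  have e := etrans (esym ya) yb.
  case: (IH _ (erefl _) e) => [|ij ab|c ij -> ->|c ij -> ->]; first by lia.
  + by rewrite ij ab; apply: CommonEq.
  + apply: (@CommonFar _ _ _ _ (c * sigma k)) => //.
      by rewrite -(mulg_sigma_far _ kj).
    by rewrite (mulg_sigma_far _ ik).
  + apply: (@CommonNear _ _ _ _ (c * sigma k)) => //.
      by rewrite -(mulg_sigma_far _ kj) (mulg_sigma_far _ ik).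
    by rewrite (mulg_sigma_far _ ik) -(mulg_sigma_far _ kj).
have [kj|kj|kj] := index_cases k j.
- by subst k; rewrite -(common_multiple_id h2).
- apply/common_multiple_sym/(common_multiple_far_near hl _ _
    (common_multiple_sym h2) (common_multiple_sym h1)).
  + by rewrite /far orbC.
  + by rewrite /near orbC.
have [a -> ya] := common_multiple_near ik h1.
have [b yb ->] := common_multiple_near kj h2.
have := congr1 length ya; have := congr1 length yb.
rewrite !lengthM !length_sigma hl => lb la.
have e := etrans (esym ya) yb.
have [ij|ij|ij] := index_cases i j; last by move: ij ik kj; rewrite /near; lia.
  subst j; have ea : a * sigma k = b * sigma k.
    by apply: garside_cancel e; rewrite lengthM length_sigma; lia.
  by rewrite (garside_cancel _ ea) ?length_sigma; [apply: CommonEq|lia].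
(* The three generators are now of type $A_3$; tracing [c] back through [d] and [d'], the common
   multiple is [f] times their lcm, of length 6. *)
have ki : near k i by rewrite /near orbC.
have [|c eac ebc] := garside_far _ ij e; first by rewrite lengthM length_sigma; lia.
have [|d ea ec] := garside_near _ kj eac; first by lia.
have [|d' eb ec'] := garside_near _ ki ebc; first by lia.
have := congr1 length ea; rewrite !lengthM !length_sigma => ld.
have ed : d * sigma j = d' * sigma i.
  apply: (@garside_cancel _ _ k); first by rewrite lengthM length_sigma; lia.
  by rewrite -ec -ec'.
have [||f ef ef'] := garside_far _ _ ed; [by lia|by rewrite /far orbC|].
rewrite ea eb ef ef'.
have ji : far j i by rewrite /far orbC.
apply: (@CommonFar _ _ _ _ (f * sigma k * sigma i * sigma j * sigma k)) => //.
  rewrite -(mulg_sigma_far (f * sigma i * sigma k) ij).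
  rewrite (mulg_sigma_near f ik).
  by rewrite (mulg_sigma_near (f * sigma k * sigma i) kj).
rewrite (mulg_sigma_far (f * sigma j * sigma k) ij) -(mulg_sigma_near f kj).
rewrite (mulg_sigma_near (f * sigma k * sigma j) ki).
by rewrite (mulg_sigma_far (f * sigma k) ij).
Qed.
End Step.

(** Along a derivation of the equality, one relation either spares the last letter or is itself an
    lcm identity; [common_multiple_trans] composes these, by induction on the length. *)
Theorem garside x i y j :
  x * sigma i = y * sigma j -> common_multiple x i y j.
Proof.
move: {2}(length x) (erefl (length x)) => l.
elim/ltn_ind: l x i y j => l IH.
have step w1 w2 : braid_eq w1 w2 -> forall u i v j, size u = l ->
    w1 = rcons u i -> w2 = rcons v j ->
    common_multiple (braid_of u) i (braid_of v) j.
  elim=> {w1 w2} [a b p q h|w|w1 w2 e h|w1 w2 w3 e12 h12 _ h23] u i v j ul.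
  - case/lastP: b => [|b k]; last first.
      rewrite -!rcons_cat => /rcons_inj[<- <-] /rcons_inj[<- <-].
      by apply: CommonEq => //; apply/braid_ofP/braid_eq_step.
    rewrite !cats0; case: h => {p q} k m h.
      rewrite -!cat_rcons !cats0 => /rcons_inj[<- <-] /rcons_inj[<- <-].
      by rewrite !braid_of_rcons; apply: (@CommonFar _ _ _ _ (braid_of a)) => //;
        rewrite /far orbC.
    rewrite -!cat_rcons !cats0 => /rcons_inj[<- <-] /rcons_inj[<- <-].
    by rewrite !braid_of_rcons; apply: (@CommonNear _ _ _ _ (braid_of a)) => //;
      rewrite /near orbC.
  - by move=> -> /rcons_inj[-> ->]; apply: CommonEq.
  - move=> e2 e1; apply/common_multiple_sym/(h v j u i) => //.
    by move: (braid_eq_size e); rewrite e1 e2 !size_rcons ul => -[].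
  - move=> e1 e3; have := braid_eq_size e12; rewrite e1 size_rcons.
    case/lastP: w2 e12 h12 h23 => [|w k] // e12 h12 h23.
    rewrite size_rcons ul => -[lw].
    apply: (@common_multiple_trans l IH _ _ (braid_of w) k) => //.
    + by rewrite length_of.
    + exact: h12.
    + exact: h23.
apply: braid_ind => u i; apply: braid_ind => v j ul e.
apply: (step (rcons u i) (rcons v j)) => //.
  by apply/braid_ofP; rewrite !braid_of_rcons.
by rewrite -ul length_of.
Qed.
End Garside.

(** * Standard parabolic submonoids *)

Section Generated.
Variable n : nat.
Implicit Types (x y z : braid n) (i j : 'I_n.-1).

Lemma sigmaI i : injective (fun x => x * sigma i).
Proof. by move=> x y /garside/common_multiple_id. Qed.

Definition gen (A : pred nat) x :=
  exists2 w : word n, all (fun i : 'I_n.-1 => A i) w & x = braid_of w.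

Lemma gen1 A : gen A 1.
Proof. by exists [::]. Qed.

Lemma genM A x y : gen A x -> gen A y -> gen A (x * y).
Proof.
move=> [u hu ->] [v hv ->]; exists (u ++ v); last by rewrite braid_ofM.
by rewrite all_cat hu.
Qed.

Lemma gen_sigma (A : pred nat) i : A i -> gen A (sigma i).
Proof. by move=> h; exists [:: i]; rewrite ?/= ?h. Qed.

Lemma gen_sub (A B : pred nat) x : {subset A <= B} -> gen A x -> gen B x.
Proof.
move=> h [w hw ->]; exists w => //.
by apply: sub_all hw => i; apply: h.
Qed.

Lemma gen_neq1 A x : gen A x -> x <> 1 ->
  exists y i, [/\ gen A y, A i & x = y * sigma i].
Proof.
move=> [w hw ->]; case/lastP: w hw => // w i; rewrite all_rcons => /andP[hi hw] _.
by exists (braid_of w), i; split=> //; [exists w|rewrite braid_of_rcons].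
Qed.

Lemma common_multiple_gen (A : pred nat) x i y j : A i -> A j ->
  common_multiple x i y j ->
  exists z a b, [/\ gen A a, gen A b & [/\ x = z * a, y = z * b &
    a * sigma i = b * sigma j]].
Proof.
move=> Ai Aj [-> ->|z h -> ->|z h -> ->].
- by exists y, 1, 1; rewrite !mulg1; split=> //; exact: gen1.
- exists z, (sigma j), (sigma i); split; try exact: gen_sigma.
  by split=> //; rewrite (sigma_far h).
exists z, (sigma i * sigma j), (sigma j * sigma i).
by split; [| |rewrite !mulgA (sigma_near h)]; try (apply: genM; exact: gen_sigma).
Qed.

(* Left lcms of elements of a standard parabolic submonoid stay in it. *)
Lemma gen_lcm (A : pred nat) x u y v : gen A u -> gen A v -> x * u = y * v ->
  exists z a b, [/\ gen A a, gen A b & [/\ x = z * a, y = z * b &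
    a * u = b * v]].
Proof.
move: {2}(length (x * u)) (erefl (length (x * u))) => l.
elim/ltn_ind: l x u y v => l IH x u y v ul gu gv e.
have [u1|/(gen_neq1 gu)[u' [i [gu' Ai uE]]]] := pselect (u = 1).
  by exists y, v, 1; split=> //; [exact: gen1|rewrite -e u1 !mulg1 mul1g].
have [v1|/(gen_neq1 gv)[v' [j [gv' Aj vE]]]] := pselect (v = 1).
  by exists x, 1, u; split=> //; [exact: gen1|rewrite e v1 !mulg1 mul1g].
(* The diagram is filled by four tiles: Garside's lemma for the last letters, then induction on
   [x * u' = z * a], on [y * v' = z * b], and on the two resulting factorizations of [z]. *)
subst u v; move: e; rewrite !mulgA => /garside h.
have [z [a [b [ga gb [xE yE ab]]]]] := common_multiple_gen Ai Aj h.
have ll : length (x * u') < l.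
  by rewrite -ul !lengthM length_sigma; lia.
have [w1 [c1 [d1 [gc1 gd1 [-> z1 e1]]]]] := IH _ ll _ _ _ _ (erefl _) gu' ga xE.
have ll' : length (z * b) < l.
  have := congr1 (@length n) ab; rewrite xE !lengthM !length_sigma in ll *; lia.
have [w2 [c2 [d2 [gc2 gd2 [yE' z2 e2]]]]] :=
  IH _ ll' _ _ _ _ (congr1 (@length n) yE) gv' gb yE.
have lz : length (w1 * d1) < l.
  by rewrite -z1; move: ll; rewrite xE lengthM; lia.
have [w [p [q [gp gq [-> w2E e3]]]]] :=
  IH _ lz _ _ _ _ (erefl _) gd1 gd2 (etrans (esym z1) z2).
exists w, (p * c1), (q * c2); split; [exact: genM|exact: genM|].
split; rewrite ?mulgA ?yE' ?w2E //.
rewrite -(mulgA p c1) e1 mulgA -mulgA ab.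
by rewrite -(mulgA q c2) e2 (mulgA q) -(mulgA _ b) mulgA e3 mulgA.
Qed.

End Generated.

(** * Ladders: increasing products ending in the top generator *)

Section Ladder.
Variable n : nat.
Implicit Types (x y z : braid n.+2).

Definition sg (k : nat) : braid n.+2 := sigma (n := n.+2) (inord k).

Lemma sgE k : k <= n -> val (inord k : 'I_n.+1) = k.
Proof. exact: inordK. Qed.

Lemma gen_sg (A : pred nat) i : i <= n -> A i -> gen A (sg i).
Proof. by move=> h hA; apply: gen_sigma; rewrite sgE. Qed.

Lemma sg_eq_far x y i j : i.+2 <= j <= n -> x * sg j = y * sg i ->
  exists2 z, x = z * sg i & y = z * sg j.
Proof.
by case/andP=> ij jn /garside/common_multiple_far; apply; rewrite /far !sgE; lia.
Qed.

Lemma sg_eq_near x y i : i.+1 <= n -> x * sg i.+1 = y * sg i ->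
  exists2 z, x = z * sg i.+1 * sg i & y = z * sg i * sg i.+1.
Proof.
by move=> h /garside/common_multiple_near; apply; rewrite /near !sgE; lia.
Qed.

Fixpoint ladder d := if d is d'.+1 then sg (n - d) * ladder d' else sg n.

(** This lemma and the next two give the left lcm of a ladder and [sg i]: far below the ladder
    [sg i] commutes with it, just below it extends the ladder, and inside it passes through as
    [sg i.+1]. *)
Lemma ladder_far d x y i : i + d < n.-1 -> x * ladder d = y * sg i ->
  exists2 z, x = z * sg i & y = z * ladder d.
Proof.
elim: d x y => [|d IH] x y /= h; first by apply: sg_eq_far; lia.
rewrite mulgA => /IH[|z1 e ->]; first by lia.
have [|z -> ->] := sg_eq_far _ e; first by lia.
by exists z; rewrite ?mulgA.
Qed.

Lemma ladder_near d x y i : (i + d).+1 = n -> x * ladder d = y * sg i ->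
  exists2 z, x = z * sg i.+1 * sg i & y = z * ladder d.+1.
Proof.
move=> h; have -> : ladder d.+1 = sg i * ladder d by congr (sg _ * _); lia.
case: d h => [|d] h /=.
  have -> : sg n = sg i.+1 by congr sg; lia.
  case/sg_eq_near=> [|z -> ->]; first by lia.
  by exists z; rewrite ?mulgA.
rewrite mulgA => /ladder_far[|z1]; first by lia.
have -> : n - d.+1 = i.+1 by lia.
case/sg_eq_near=> [|z -> ->]; first by lia.
by exists z; rewrite ?mulgA.
Qed.

Lemma ladder_shift d x y i : d <= n -> n - d <= i < n ->
  x * ladder d = y * sg i -> exists2 z, x = z * sg i.+1 & y = z * ladder d.
Proof.
elim: d x y => [|d IH] x y h; first by lia.
case/andP=> h1 h2 /=; rewrite mulgA; have [e|ne] := eqVneq i (n - d.+1).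
  case/ladder_near=> [|z]; first by lia.
  rewrite e => /sigmaI ->; rewrite /= => ->; exists z => //.
case/IH=> [||z1 e1 ->]; try by lia.
have [|z -> ->] := sg_eq_far _ (esym e1); first by lia.
by exists z; rewrite ?mulgA.
Qed.

Lemma gen_commute (A : pred nat) x i :
  (forall j, A j -> j.+2 <= i) -> i <= n -> gen A x -> x * sg i = sg i * x.
Proof.
move=> hA hi [w hw ->]; elim: w hw => [_|j w IH] /=.
  by rewrite braid_of_nil mulg1 mul1g.
case/andP=> /hA hj /IH h; rewrite braid_of_cons -mulgA h !mulgA.
by congr (_ * _); apply: sigma_far; rewrite /far sgE // hj.
Qed.

(* The complement of the top generator with respect to an element of the     *)
(* submonoid generated by the other ones is always a ladder.                  *)
Lemma ladder_divides d x y t : d <= n -> gen (fun i => i < n) t ->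
  y * t = x * ladder d ->
  exists e z q r, [/\ d <= e <= n, y = z * ladder e, x = z * q * r,
    gen (fun i => n - e < i) q & gen (fun i => i < n - d) r].
Proof.
move=> hd [w hw ->] {t}; elim/last_ind: w d x hd hw => [|w i IH] d x hd.
  rewrite braid_of_nil mulg1 => _ ->.
  exists d, x, 1, 1; rewrite !mulg1; split=> //; try exact: gen1.
  by rewrite leqnn.
rewrite all_rcons => /andP[hi hw].
have -> : braid_of (rcons w i) = braid_of w * sg i.
  rewrite braid_of_rcons /sg; congr (_ * sigma _).
  by apply: val_inj; rewrite /= inordK.
rewrite mulgA => e.
(* The last letter of [t] is far below the ladder and goes into [r], or inside it and goes into [q]
   as [sg i.+1], or just below it; then the ladder grows and both [q] and [r] gain a letter. *)
have [h|h|h] := ltngtP (i + d).+1 n.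
- have [|z -> yE] := ladder_far _ (esym e); first by lia.
  have [e' [z' [q [r [he -> -> gq gr]]]]] := IH _ _ hd hw yE.
  exists e', z', q, (r * sg i); rewrite ?mulgA; split=> //.
  apply: genM => //; apply: gen_sg; lia.
- have [||z -> yE] := ladder_shift _ _ (esym e); try by lia.
  have [e' [z' [q [r [he -> -> gq gr]]]]] := IH _ _ hd hw yE.
  have comm : r * sg i.+1 = sg i.+1 * r by apply: gen_commute gr => [j|]; lia.
  exists e', z', (q * sg i.+1), r; split=> //.
    by rewrite -mulgA comm !mulgA.
  apply: genM => //; apply: gen_sg; lia.
have [|z -> yE] := ladder_near _ (esym e); first by lia.
have [|e' [z' [q [r [he -> -> gq gr]]]]] := IH _ _ _ hw yE; first by lia.
have comm : r * sg i.+1 = sg i.+1 * r by apply: gen_commute gr => [j|]; lia.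
exists e', z', (q * sg i.+1), (r * sg i); split=> //; first by lia.
- by rewrite -(mulgA _ r (sg i.+1)) comm !mulgA.
- by apply: genM => //; apply: gen_sg; lia.
- apply: genM; last by apply: gen_sg; lia.
  by apply: gen_sub gr => j; rewrite !unfold_in; lia.
Qed.

End Ladder.

Arguments sg {n} k.
Arguments ladder {n} d.

(** * Lexicographic and ShortLex orders *)

Section Lex.
Variables (T : Type) (R : T -> T -> Prop).
Implicit Types s t u : seq T.

Definition lex s t := exists u a b s' t',
  [/\ s = u ++ a :: s', t = u ++ b :: t' & R a b].

Lemma lex_cons a b s t : lex (a :: s) (b :: t) <-> R a b \/ a = b /\ lex s t.
Proof.
split=> [[[|c u] [a' [b' [s' [t' /= [[-> ->] [-> ->] h]]]]]]|]; first by left.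
  by right; split=> //; exists u, a', b', s', t'.
case=> [h|[-> [u [a' [b' [s' [t' [-> -> h]]]]]]]]; first by exists [::], a, b, s, t.
by exists (b :: u), a', b', s', t'.
Qed.

Lemma lex_nil s : ~ lex [::] s.
Proof. by case=> [[|c u] [a' [b' [s' [t' []]]]]]. Qed.

Lemma lex_trans : (forall a b c, R a b -> R b c -> R a c) ->
  forall s t u, lex s t -> lex t u -> lex s u.
Proof.
move=> trR; elim=> [|a s IH] [|b t] [|c u]; try by move=> /lex_nil.
- by move=> _ /lex_nil.
- by move=> _ /lex_nil.
- by move=> _ [[|? ?] [? [? [? [? []]]]]].
rewrite !lex_cons => -[ab|[-> st]] [bc|[<- tu]]; try by left; eauto.
by right; split; eauto.
Qed.

Lemma lex_cat s t u v : lex s t -> lex (s ++ u) (t ++ v).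
Proof.
case=> [w [a [b [s' [t' [-> -> h]]]]]]; exists w, a, b, (s' ++ u), (t' ++ v).
by rewrite -!catA.
Qed.

(** At fixed length one minimizes the first entry, then the tail among the sequences with that first
    entry. *)
Lemma lex_min : (forall P : T -> Prop, (exists a, P a) ->
    exists2 a, P a & forall b, P b -> ~ R b a) ->
  forall p (P : seq T -> Prop), (exists2 s, size s = p & P s) ->
    exists s, [/\ size s = p, P s & forall t, size t = p -> P t -> ~ lex t s].
Proof.
move=> minR; elim=> [|p IH] P [s sp Ps].
  by exists s; split=> // t; move/size0nil => -> _ /lex_nil.
case: s sp Ps => // a s [sp] Ps.
have [|a1 [s1 s1p Ps1] amin] := minR (fun a => exists2 s, size s = p & P (a :: s)).
  by exists a, s.
have [|s2 [s2p Ps2 smin]] := IH (fun s => P (a1 :: s)); first by exists s1.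
exists (a1 :: s2); split=> [|//|[//|b t] [tp] Pt]; first by rewrite /= s2p.
rewrite lex_cons => -[ba|[ba ts]]; first by apply: (amin b) => //; exists t.
by subst b; apply: (smin t).
Qed.

End Lex.

Lemma shortlexS k (s t : nat_seq k.+1) : shortlex s t <->
  size s < size t \/ size s = size t /\ lex (@shortlex k) s t.
Proof. by []. Qed.

Lemma shortlex_trans k (s t u : nat_seq k) :
  shortlex s t -> shortlex t u -> shortlex s u.
Proof.
elim: k s t u => [|k IH] s t u; first exact: ltn_trans.
rewrite !shortlexS => -[st|[st lst]] [tu|[tu ltu]].
- by left; apply: ltn_trans tu.
- by left; rewrite -tu.
- by left; rewrite st.
by right; split; [rewrite st|apply: lex_trans ltu].
Qed.

Lemma shortlex_min k (P : nat_seq k -> Prop) : (exists s, P s) ->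
  exists2 s, P s & forall t, P t -> ~ shortlex t s.
Proof.
have minN (Q : nat -> Prop) : (exists m, Q m) ->
    exists2 m, Q m & forall m', Q m' -> ~ m' < m.
  move=> [m Qm]; have ex : exists m, `[< Q m >] by exists m; apply/asboolP.
  case: (ex_minnP ex) => m' /asboolP Qm' hmin; exists m' => // i Qi.
  have := hmin i; case: asboolP => // _ /(_ isT); lia.
elim: k P => [|k IH] P; first exact: minN.
case=> s Ps; have [|p [s1 s1p Ps1] pmin] :=
  minN (fun p => exists2 s, size s = p & P s); first by exists (size s), s.
have [|s2 [s2p Ps2 s2min]] := lex_min IH (p := p) (P := P); first by exists s1.
exists s2 => // t Pt; rewrite shortlexS s2p => -[h|[h1 h2]].
  by apply: (pmin (size t)) h; exists t.
exact: (s2min t).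
Qed.

Lemma shortlex_ind k (Q : nat_seq k -> Prop) :
  (forall s, (forall t, shortlex t s -> Q t) -> Q s) -> forall s, Q s.
Proof.
move=> h s; apply: contrapT => nQs.
have [|t nQt tmin] := shortlex_min (P := fun s => ~ Q s); first by exists s.
by apply/nQt/h => u ut; apply: contrapT => /tmin.
Qed.

(** * The flip and the inclusion, on braids and on splittings *)

Section Flip.
Variable n : nat.

Lemma braid_flipM (x y : braid n) :
  braid_flip (x * y) = braid_flip x * braid_flip y.
Proof.
move: x y; apply: braid_ind => u; apply: braid_ind => v.
by rewrite -braid_ofM !braid_flip_of word_flip_cat braid_ofM.
Qed.

Lemma braid_flipK : involutive (@braid_flip n).
Proof. by apply: braid_ind => w; rewrite !braid_flip_of word_flipK. Qed.

Lemma braid_flip1 : braid_flip (1 : braid n) = 1.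
Proof. by rewrite -braid_of_nil braid_flip_of. Qed.

Lemma braid_flip_sigma (i : 'I_n.-1) : braid_flip (sigma i) = sigma (rev_ord i).
Proof. by rewrite /sigma braid_flip_of. Qed.

Lemma gen_flip (A B : pred nat) (x : braid n) :
  (forall i : 'I_n.-1, A i -> B (rev_ord i)) -> gen A x -> gen B (braid_flip x).
Proof.
move=> h [w hw ->]; rewrite braid_flip_of; exists (word_flip w) => //.
by rewrite all_map; apply: sub_all hw => i /= /h.
Qed.

End Flip.

Section Inclusion.
Variable n : nat.

Lemma braid_inclM (x y : braid n) :
  braid_incl (x * y) = braid_incl x * braid_incl y.
Proof.
move: x y; apply: braid_ind => u; apply: braid_ind => v.
by rewrite -braid_ofM !braid_incl_of /word_incl map_cat braid_ofM.
Qed.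

Lemma braid_incl_sigma (i : 'I_n.-1) :
  braid_incl (sigma i) = sigma (n := n.+1) (letter_incl i).
Proof. by rewrite /sigma braid_incl_of. Qed.

Lemma gen_incl (A : pred nat) (x : braid n) : gen A x -> gen A (braid_incl x).
Proof.
case=> w hw ->; rewrite braid_incl_of; exists (word_incl w) => //.
by rewrite all_map; apply: sub_all hw.
Qed.

Lemma gen_full (x : braid n) : gen (fun i => i < n.-1) x.
Proof. by move: x; apply: braid_ind => w; exists w => //; apply/allP => i _ /=. Qed.

Lemma gen_inclP (A : pred nat) (x : braid n.+1) : (forall i, A i -> i < n.-1) ->
  gen A x -> exists2 y : braid n, gen A y & x = braid_incl y.
Proof.
move=> hA [w hw ->].
have nw : no_top w.
  by apply: sub_all hw => i /= /hA; rewrite is_topE negbK.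
exists (braid_of (word_restr w)); last by rewrite braid_incl_of word_restrK.
exists (word_restr w) => //.
by move: hw; rewrite -{1}(word_restrK nw) all_map; apply: sub_all.
Qed.

Lemma braid_incl_sigmaP (y : braid n) (x : braid n.+1) (i : 'I_n) :
  braid_incl y = x * sigma (n := n.+1) i ->
  exists z j, [/\ x = braid_incl z, i = letter_incl j & y = z * sigma j].
Proof.
move: y x; apply: braid_ind => v; apply: braid_ind => w.
rewrite braid_incl_of -braid_of_rcons => /braid_ofP/braid_eq_restr[].
rewrite no_top_incl => /esym nw /(_ isT) e.
have [w' wE] : exists w', rcons w i = word_incl w'.
  by exists (word_restr (rcons w i)); rewrite word_restrK.
move: e; rewrite wE !word_inclK => /braid_ofP ->.
case/lastP: w' wE => [|w' j]; first by move=> /(congr1 size); rewrite size_rcons.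
rewrite /word_incl map_rcons => /rcons_inj[-> ->].
by exists (braid_of w'), j; rewrite braid_incl_of braid_of_rcons.
Qed.

Lemma word_tail_cat (v : word n.+1) (i : 'I_n) (w : word n) : is_top i ->
  word_tail (rcons v i ++ word_incl w) = word_incl w /\
  word_head (rcons v i ++ word_incl w) = rcons v i.
Proof.
move=> hi; have e : suffix_length (rcons v i ++ word_incl w) = size w.
  rewrite /suffix_length rev_cat rev_rcons find_cat ifN /=; last first.
    rewrite has_rev; have := no_top_incl w.
    by rewrite /no_top all_predC.
  by rewrite hi addn0 size_rev size_map.
have e' : size (rcons v i ++ word_incl w) - size w = size (rcons v i).
  by rewrite size_cat size_map addnK.
by rewrite /word_tail /word_head e e' drop_size_cat // take_size_cat.
Qed.

Lemma word_splitting_incl (w : word n) : 2 <= n ->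
  word_splitting (word_incl w) = [:: w].
Proof.
move=> n2; have e : suffix_length (word_incl w) = size w.
  rewrite /suffix_length hasNfind ?size_rev ?size_map // has_rev -all_predC.
  exact: no_top_incl.
rewrite word_splittingE // /word_head /word_tail e size_map subnn take0 drop0.
by rewrite word_inclK.
Qed.

Lemma word_splitting_flip (v : word n.+1) (i : 'I_n) (w : word n) : 2 <= n ->
  is_top i -> word_splitting (rcons v i ++ word_incl w) =
    rcons (word_splitting (word_flip (rcons v i))) w.
Proof.
move=> n2 hi; have [ht hh] := word_tail_cat v w hi.
by rewrite word_splittingE // ht hh word_inclK; case: v {ht hh}.
Qed.

Lemma word_splitting_gt0 (w : word n.+1) : 0 < size (word_splitting w).
Proof. by rewrite /word_splitting /=; case: ifP => //; rewrite size_rcons. Qed.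

Lemma braid_alt_map (ws : seq (word n)) :
  braid_alt (map (@braid_of n) ws) = braid_of (word_alt ws).
Proof.
elim: ws => //= w ws ->; rewrite size_map braid_ofM braid_incl_of.
congr (_ * _); elim: (size ws) => //= p ->; exact: braid_flip_of.
Qed.

Lemma braid_alt_rcons (xs : seq (braid n)) x :
  braid_alt (rcons xs x) = braid_flip (braid_alt xs) * braid_incl x.
Proof.
elim: xs => [|y xs IH] /=; first by rewrite mulg1 braid_flip1 mul1g.
by rewrite IH size_rcons braid_flipM /= mulgA.
Qed.

End Inclusion.

(** * Decreasing words and minimal alternating decompositions *)

Definition ltw n (v w : word n) :=
  shortlex (exponent_sequence v) (exponent_sequence w).

(* The case u = 1 is the wanted one: deleting the last letter decreases the   *)
(* exponent sequence. Ladders produce a general u in the induction step.      *)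
Definition decreasing n := forall (w : word n) x i u,
  braid_of w = x * sigma i -> gen (fun j => j < i) u ->
  exists2 v, braid_of v = x * u & ltw v w.

Lemma decreasing2 : decreasing 2.
Proof.
move=> w x i u wE [v hv ->]; case: v hv => [_|j v /andP[]]; last first.
  by rewrite (ord1 i).
exists (repr x); first by rewrite repr_braidK mulg1.
have := congr1 (@length 2) wE.
by rewrite length_of lengthM length_sigma /ltw /= addn1 /length => ->.
Qed.

Section Sequences.
Variable m : nat.
Let n := m.+2.
Implicit Types (ws ts ss : seq (word n)) (x y z : braid n.+1).

Definition exps ws : nat_seq m.+1 := map (@exponent_sequence n) ws.
Definition lts ts ws := shortlex (exps ts) (exps ws).
Definition alt ws : braid n.+1 := braid_of (word_alt ws).

Lemma alt_rcons ws w :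
  alt (rcons ws w) = braid_flip (alt ws) * braid_incl (braid_of w).
Proof. by rewrite /alt word_alt_rcons braid_ofM braid_incl_of braid_flip_of. Qed.

Lemma alt1 w : alt [:: w] = braid_incl (braid_of w).
Proof. by rewrite /alt /= cats0 braid_incl_of. Qed.

(** The lengths of [ws] and [ws'] may differ: flips are counted from the right end, so a prefix
    enters only through its own product. *)
Lemma alt_cat ws ws' ts : alt ws = alt ws' -> alt (ws ++ ts) = alt (ws' ++ ts).
Proof.
move=> e; elim/last_ind: ts => [|ts t IH]; first by rewrite !cats0.
by rewrite -!rcons_cat !alt_rcons IH.
Qed.

Lemma lts_size ts ws : size ts < size ws -> lts ts ws.
Proof. by move=> h; left; rewrite !size_map. Qed.

Lemma lts_cat ts ws us : lts ts ws -> lts (ts ++ us) (ws ++ us).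
Proof.
rewrite /lts !shortlexS /exps !map_cat !size_cat !size_map => -[h|[-> h]].
  by left; rewrite ltn_add2r.
by right; split=> //; apply: lex_cat.
Qed.

(** A decrease in the prefix outweighs any change of the last entry, so letters may be pushed into
    it freely. *)
Lemma lts_rcons ts ws v w : lts ts ws -> lts (rcons ts v) (rcons ws w).
Proof.
rewrite /lts !shortlexS /exps !map_rcons !size_rcons !size_map ltnS.
case=> [h|[-> h]]; first by left.
by right; split=> //; rewrite -!cats1; apply: lex_cat.
Qed.

Lemma lts_subst us v w ts : ltw v w -> lts (us ++ v :: ts) (us ++ w :: ts).
Proof.
move=> h; right; split; first by rewrite !size_map !size_cat.
exists (exps us), (exponent_sequence v), (exponent_sequence w).
exists (exps ts), (exps ts).
by rewrite /exps !map_cat.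
Qed.

Lemma lts_trans ws ts us : lts ws ts -> lts ts us -> lts ws us.
Proof. exact: shortlex_trans. Qed.

Lemma lts_ind (Q : seq (word n) -> Prop) :
  (forall ws, (forall ts, lts ts ws -> Q ts) -> Q ws) -> forall ws, Q ws.
Proof.
move=> h ws; move: {2}(exps ws) (erefl (exps ws)) => e.
elim/shortlex_ind: e ws => e IH ws we; apply: h => ts.
by rewrite /lts we => /IH; apply.
Qed.

Lemma lts_min (P : seq (word n) -> Prop) : (exists ws, P ws) ->
  exists2 ws, P ws & forall ts, P ts -> ~ lts ts ws.
Proof.
case=> ws0 P0.
have [|e [ws Pws <-] hmin] :=
  shortlex_min (P := fun e => exists2 ws, P ws & exps ws = e).
  by exists (exps ws0), ws0.
by exists ws => // ts Pts; apply: hmin; exists ts.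
Qed.

Lemma flip_sg i :
  i <= m.+1 -> braid_flip (sg (n := m.+1) i) = sg (m.+1 - i).
Proof.
move=> hi; rewrite /sg braid_flip_sigma; congr sigma.
apply: val_inj; rewrite /= !inordK //; lia.
Qed.

Lemma sg_incl i :
  i <= m -> sg (n := m.+1) i = braid_incl (sigma (n := n) (inord i)).
Proof.
move=> hi; rewrite braid_incl_sigma; congr sigma.
apply: val_inj; rewrite /= !inordK //; lia.
Qed.

Hypothesis decr : decreasing n.

Lemma decreasing_incl w x i u : i <= m.+1 ->
  braid_incl (braid_of w) = x * sg i -> gen (fun j => j < i) u ->
  exists2 v, braid_incl (braid_of v) = x * u & ltw v w.
Proof.
move=> hi /braid_incl_sigmaP[x' [j [-> ij we]]] gu.
have ji : i = j by rewrite -[LHS](inordK (hi : i < m.+2)) ij.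
have [|u' gu' ->] := gen_inclP _ gu.
  by move=> k hk; apply: leq_trans (ltn_ord j); rewrite -ji ltnS ltnW.
rewrite ji in gu'; have [v ve vw] := decr we gu'.
by exists v; rewrite // ve braid_inclM.
Qed.

Lemma flip_ladder0 : braid_flip (ladder (n := m.+1) 0) = sg 0.
Proof. by rewrite flip_sg // subnn. Qed.

Lemma flip_ladderS d : d < m.+1 ->
  braid_flip (ladder (n := m.+1) d.+1) = sg d.+1 * braid_flip (ladder d).
Proof. by move=> h; rewrite braid_flipM flip_sg ?leq_subr // subKn. Qed.

Lemma decreasing_seq ws x i u : 0 < size ws -> i <= m.+1 ->
  alt ws = x * sg i -> gen (fun j => j < i) u ->
  exists ts, [/\ 0 < size ts, alt ts = x * u & lts ts ws].
Proof.
elim/lts_ind: ws x i u => ws; case/lastP: ws => // ss w IH x i u _ hi.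
have [/size0nil ->|ss0] := posnP (size ss).
  rewrite alt1 => /(decreasing_incl hi) /[apply] -[v ve vw].
  by exists [:: v]; rewrite alt1; split=> //; apply: (lts_subst [::] [::]).
rewrite alt_rcons; have [im wE gu|im] := ltnP i m.+1.
  (* If a generator other than $\sigma_1$ divides [alt ss], delete it there, put its flip in front
     of [w], and apply induction to this smaller sequence for the same braid. *)
  have [[j [z [hj ssE]]]|red] :=
      pselect (exists j z, 0 < j <= m.+1 /\ alt ss = z * sg j).
    have ss_lt : lts ss (rcons ss w) by apply: lts_size; rewrite size_rcons.
    have [|ts [_ tsE ts_lt]] := IH _ ss_lt z j 1 ss0 _ ssE (gen1 _ _).
      by case/andP: hj.
    have lt' : lts (rcons ts (inord (m.+1 - j) :: w)) (rcons ss w).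
      exact: lts_rcons.
    have [||ts' [ts'0 ts'E ts'_lt]] := IH _ lt' x i u _ hi _ gu.
    - by rewrite size_rcons.
    - rewrite alt_rcons tsE mulg1 braid_of_cons braid_inclM -sg_incl; last by lia.
      by rewrite mulgA -flip_sg -?braid_flipM -?ssE //; lia.
    by exists ts'; split=> //; apply: lts_trans lt'.
  (* Otherwise the cofactor [b] of [w] in its lcm with [sg i] is trivial, as its last letter would
     flip to such a divisor; so [sg i] divides [w] itself. *)
  have gw := gen_incl (gen_full (braid_of w)).
  have [z [a [b [ga gb [xE fE e]]]]] :=
    gen_lcm (gen_sg (A := fun j => j < m.+1) hi im) gw (esym wE).
  have b1 : b = 1.
    apply: contrapT => /(gen_neq1 gb)[b' [j [_ hj bE]]].
    apply: red; exists (m.+1 - j), (braid_flip (z * b')); split; first by lia.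
    have -> : sg (m.+1 - j) = braid_flip (sigma (n := n.+1) j).
      rewrite -flip_sg; last by lia.
      by rewrite /sg inord_val.
    by rewrite -braid_flipM -mulgA -bE -fE braid_flipK.
  move: fE e; rewrite b1 mulg1 mul1g => fE e.
  have [v vE vw] := decreasing_incl hi (esym e) gu.
  exists (rcons ss v); split; first by rewrite size_rcons.
    by rewrite alt_rcons vE fE mulgA -xE.
  by rewrite -!cats1; apply: lts_subst.
have {im hi} -> : i = m.+1 by lia.
move=> wE gu.
(* The flipped ladder is [sg e * ... * sg 0]. Its letters are deleted from the right, except that
   [sg e] is traded for [q], which lies in the lower generators. *)
have drop e y q ts : e <= m.+1 -> 0 < size ts -> lts ts (rcons ss w) ->
    alt ts = y * braid_flip (ladder e) -> gen (fun j => j < e) q ->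
    exists ts', [/\ 0 < size ts', alt ts' = y * q & lts ts' ts].
  elim: e y q => [|e IHe] y q he ts0 ts_lt.
    by rewrite flip_ladder0 => tsE gq; apply: (IH _ ts_lt) tsE gq.
  rewrite flip_ladderS // mulgA => tsE gq.
  have [t1 [t10 t1E t1_lt]] := IHe _ 1 (ltnW he) ts0 ts_lt tsE (gen1 _ _).
  rewrite mulg1 in t1E.
  have [t2 [t20 t2E t2_lt]] := IH _ (lts_trans t1_lt ts_lt) _ _ _ t10 he t1E gq.
  by exists t2; split=> //; apply: lts_trans t1_lt.
have gw := gen_incl (gen_full (braid_of w)).
have [e [z [q [r [he fE -> gq gr]]]]] :=
  ladder_divides (n := m.+1) (d := 0) (leq0n _) gw wE.
have [||||ts [ts0 tsE ts_lt]] :=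
    drop e (braid_flip z) (braid_flip q) ss _ ss0.
- by case/andP: he.
- by apply: lts_size; rewrite size_rcons.
- by rewrite -braid_flipM -fE braid_flipK.
- by apply: gen_flip gq => j /=; rewrite /n /=; have /= := ltn_ord j; rewrite /n; lia.
have gru : gen (fun j => j < m.+1) (r * u).
  by apply: genM gu; apply: gen_sub gr => j; rewrite !unfold_in subn0.
have [//|y _ ruE] := gen_inclP _ gru.
exists (rcons ts (repr y)); split; first by rewrite size_rcons.
  by rewrite alt_rcons tsE repr_braidK -ruE braid_flipM !braid_flipK !mulgA.
exact: lts_rcons.
Qed.

Definition minimal ws :=
  forall ts, 0 < size ts -> alt ts = alt ws -> ~ lts ts ws.

Lemma minimal_prefix ss ts : 0 < size ss -> minimal (ss ++ ts) -> minimal ss.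
Proof.
move=> ss0 h us us0 usE us_lt; apply: (h (us ++ ts)).
- by rewrite size_cat; lia.
- exact: alt_cat.
- exact: lts_cat.
Qed.

Lemma minimal_last ss w (i : 'I_m.+2) z : 0 < size ss -> minimal (rcons ss w) ->
  alt ss = z * sigma (n := n.+1) i -> i = 0 :> nat.
Proof.
move=> ss0 h ssE; apply/eqP/contraT; rewrite -lt0n => i0.
have im : i <= m.+1 by rewrite -ltnS.
have ssE' : alt ss = z * sg i by rewrite /sg inord_val.
have [ts [ts0 tsE ts_lt]] := decreasing_seq ss0 im ssE' (gen1 _ _).
rewrite mulg1 in tsE.
exfalso; apply: (h (rcons ts (inord (m.+1 - i) :: w))).
- by rewrite size_rcons.
- rewrite !alt_rcons tsE ssE' braid_flipM flip_sg // braid_of_cons braid_inclM.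
  by rewrite -sg_incl ?mulgA //; lia.
- exact: lts_rcons.
Qed.

Lemma minimal_neq1 ss w : 0 < size ss -> minimal (rcons ss w) -> alt ss <> 1.
Proof.
move=> ss0 h ss1; apply: (h [:: w]) => //.
  by rewrite alt_rcons alt1 ss1 braid_flip1 mul1g.
by apply: lts_size; rewrite size_rcons.
Qed.

Lemma minimal_word_splitting ws :
  0 < size ws -> minimal ws -> word_splitting (word_alt ws) = ws.
Proof.
elim/last_ind: ws => // ss w IH _ h; rewrite word_alt_rcons.
have [/size0nil ->|ss0] := posnP (size ss); first exact: word_splitting_incl.
have hss : minimal ss by apply: (minimal_prefix (ts := [:: w])); rewrite ?cats1.
have := IH ss0 hss; have := minimal_last ss0 h; have := minimal_neq1 ss0 h.
rewrite /alt; case/lastP: (word_alt ss) => // v i _ /(_ i (braid_of v)).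
rewrite braid_of_rcons => /(_ erefl) i0 vE.
have ti : is_top (rev_ord i) by rewrite /is_top /= i0 subn1.
by rewrite {1}/word_flip map_rcons word_splitting_flip // -map_rcons -/(word_flip _)
  word_flipK vE.
Qed.

Lemma lts_word_splitting ws w : 0 < size ws -> lts ws (word_splitting w) ->
  exists2 v : word n.+1, braid_of v = alt ws & ltw v w.
Proof.
move=> ws0 ws_lt.
have [|ts [ts0 tsE ts_lt] hmin] := lts_min (P := fun ts =>
  [/\ 0 < size ts, alt ts = alt ws & lts ts (word_splitting w)]).
  by exists ws.
have ts_min : minimal ts.
  move=> us us0 usE us_lt; apply: (hmin us) => //.
  by split; rewrite ?usE //; apply: lts_trans ts_lt.
exists (word_alt ts) => //.
by rewrite /ltw /= -/n minimal_word_splitting.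
Qed.

Lemma decreasingS : decreasing n.+1.
Proof.
move=> w x i u wE gu; have im : i <= m.+1 by rewrite -ltnS.
have ws0 := word_splitting_gt0 w.
have wsE : alt (word_splitting w) = x * sg i.
  by rewrite /alt word_splittingK // wE /sg inord_val.
have [ts [ts0 <- ts_lt]] := decreasing_seq ws0 im wsE gu.
exact: lts_word_splitting.
Qed.

Lemma Burckel_minimal w : @Burckel_normal n.+1 w -> minimal (word_splitting w).
Proof.
move=> h ts ts0 tsE /(lts_word_splitting ts0)[v vE]; apply: h.
by rewrite vE tsE /alt word_splittingK.
Qed.

Lemma minimal_Burckel ws w : minimal ws -> w \in ws -> Burckel_normal w.
Proof.
move=> h /splitPr ws_w; case: ws_w h => us ts h v vE vw.
apply: (h (us ++ v :: ts)); last exact: lts_subst.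
  by rewrite size_cat addnS. 
by rewrite -!cat_rcons; apply: alt_cat; rewrite !alt_rcons vE.
Qed.

Lemma minimal_splitting ws : 0 < size ws -> minimal ws ->
  braid_splitting (alt ws) (map (@braid_of n) ws).
Proof.
move=> ws0 h; split; rewrite ?size_map ?braid_alt_map // => r /andP[r2 rp] i.
have hsz : (size ws - r).+1 < size ws by lia.
rewrite -map_take braid_alt_map; set ss := take _ ws.
have ss0 : 0 < size ss by rewrite size_takel // ltnW.
have {}h : minimal (rcons ss (nth [::] ws (size ws - r).+1)).
  apply: (minimal_prefix (ts := drop (size ws - r).+2 ws)).
    by rewrite size_rcons.
  by rewrite -take_nth // cat_take_drop.
split=> [[z]|i0]; first exact: minimal_last ss0 h.
have : gen (fun=> true) (alt ss) by exists (word_alt ss) => //; apply/allP.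
case/gen_neq1; first exact: minimal_neq1 h.
move=> y [j [_ _ ssE]]; exists y.
have -> : i = j by apply: val_inj; rewrite /= i0 (minimal_last ss0 h ssE).
exact: ssE.
Qed.

End Sequences.

Lemma decreasing_all n : 2 <= n -> decreasing n.
Proof.
case: n => [|[|n]] // _; elim: n => [|n IH]; first exact: decreasing2.
exact: decreasingS.
Qed.

Lemma Burckel_exists n (x : braid n) : exists w, Burckel_normal_form x w.
Proof.
have [|e [w wx <-] hmin] := shortlex_min (P := fun e =>
  exists2 w : word n, braid_of w = x & exponent_sequence w = e).
  by exists (exponent_sequence (repr x)), (repr x); rewrite ?repr_braidK.
exists w; split=> // v vw; apply: hmin; exists v => //.
by rewrite vw.
Qed.

Lemma Forall2_map (T U : eqType) (R : T -> U -> Prop) (f : U -> T) (us : seq U) :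
  (forall u, u \in us -> R (f u) u) -> List.Forall2 R (map f us) us.
Proof.
elim: us => /= [|u us IH] h; first exact: List.Forall2_nil.
apply: List.Forall2_cons; first by apply: h; rewrite mem_head.
by apply: IH => v hv; apply: h; rewrite inE hv orbT.
Qed.

Lemma Burckel_Phi n (w : word n) : 2 <= n -> Burckel_normal w ->
  Phi_normal_form (braid_of w) w.
Proof.
case: n w => [|[|n]] // w _; elim: n w => [|n IH] w h.
  have wE : w = nseq (size w) ord0.
    by elim: (w) => //= i v {1}->; rewrite [i]ord1.
  exists (size w); split=> //; rewrite {1}wE; elim: (size w) => //= p IHp.
  by rewrite braid_of_cons IHp -expgS.
have decr : decreasing n.+2 by apply: decreasing_all.
have hm := Burckel_minimal decr h; have w0 := word_splitting_gt0 w.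
exists (map (@braid_of _) (word_splitting w)), (word_splitting w); split.
- have := minimal_splitting decr w0 hm.
  by rewrite /alt word_splittingK.
- by apply: Forall2_map => v /(minimal_Burckel hm); apply: IH.
- by rewrite word_splittingK.
Qed.

Section Uniqueness.
Variable m : nat.
Let n := m.+2.
Implicit Types (x y z : braid n.+1) (xs : seq (braid n)).

Lemma flip_bottom_coprime x z c :
  (forall i : 'I_n, right_divisor (sigma (n := n.+1) i) x -> i = 0 :> nat) ->
  braid_flip x = z * c -> gen (fun j => j < m.+1) c -> c = 1.
Proof.
move=> hx xE gc; apply: contrapT => /(gen_neq1 gc)[c' [i [_ hi cE]]].
suff /hx /= : right_divisor (sigma (n := n.+1) (rev_ord i)) x.
  by move/eqP; rewrite subn_eq0 leqNgt => /negP; apply; exact: hi.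
exists (braid_flip (z * c')).
by rewrite -braid_flip_sigma -braid_flipM -mulgA -cE -xE braid_flipK.
Qed.

Lemma splitting_rcons x xs (y : braid n) : braid_splitting x (rcons xs y) ->
  [/\ x = braid_flip (braid_alt xs) * braid_incl y,
    forall i : 'I_n, right_divisor (sigma (n := n.+1) i) (braid_alt xs) ->
      i = 0 :> nat,
    0 < size xs -> braid_alt xs <> 1 &
    0 < size xs -> braid_splitting (braid_alt xs) xs].
Proof.
have nodiv (i : 'I_n) : ~ right_divisor (sigma (n := n.+1) i) 1.
  by case=> z /(congr1 (@length _)); rewrite length1 lengthM length_sigma addn1.
rewrite /braid_splitting braid_alt_rcons size_rcons => -[_ -> h].
have hxs : 0 < size xs -> forall i : 'I_n,
    right_divisor (sigma (n := n.+1) i) (braid_alt xs) <-> i = 0 :> nat.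
  move=> xs0 i; have := h 2 _ i.
  by rewrite -cats1 subSS subn1 prednK // take_size_cat //; apply.
split=> //.
- move=> i; have [/size0nil -> /nodiv //|xs0] := posnP (size xs).
  by move/(hxs xs0).
- by move=> xs0 e; have /hxs := xs0; rewrite e => /(_ ord0)[_ /(_ erefl)/nodiv].
- move=> xs0; split=> // r hr i; have := h r.+1 _ i.
  rewrite -cats1 subSS takel_cat; first by apply; lia.
  by lia.
Qed.

Lemma splitting_unique x xs xs' :
  braid_splitting x xs -> braid_splitting x xs' -> xs = xs'.
Proof.
elim/last_ind: xs x xs' => [|xs y IH] x xs'; first by case.
case/lastP: xs' => [|xs' y'] => [_ []|] //.
move=> /splitting_rcons[-> hd hn hs] /splitting_rcons[e hd' hn' hs'].
have gy := gen_incl (gen_full y); have gy' := gen_incl (gen_full y').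
have [z [c [c' [gc gc' [xE xE' e']]]]] := gen_lcm gy gy' e.
have c1 := flip_bottom_coprime hd xE gc.
have c1' := flip_bottom_coprime hd' xE' gc'.
move: e' xE xE'; rewrite c1 c1' !mul1g !mulg1 => /braid_incl_inj -> <-.
move/(can_inj (@braid_flipK _)) => xsE; congr rcons.
have [xs0|xs0] := posnP (size xs); have [xs0'|xs0'] := posnP (size xs').
- by rewrite (size0nil xs0) (size0nil xs0').
- by case: (hn' xs0'); rewrite xsE (size0nil xs0).
- by case: (hn xs0); rewrite -xsE (size0nil xs0').
by apply: (IH _ _ (hs xs0)); rewrite -xsE; apply: hs'.
Qed.

End Uniqueness.

Lemma Forall2_uniq (T U : Type) (R : T -> U -> Prop) ts us us' :
  (forall t u u', R t u -> R t u' -> u = u') ->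
  List.Forall2 R ts us -> List.Forall2 R ts us' -> us = us'.
Proof.
move=> hR h; elim: h us' => {ts us} [|t u ts us tu _ IH] us' h; inversion h => //.
by rewrite (hR _ _ _ tu H1) (IH _ H3).
Qed.

Lemma Phi_normal_form_unique n (x : braid n) w w' : 2 <= n ->
  Phi_normal_form x w -> Phi_normal_form x w' -> w = w'.
Proof.
case: n x w w' => [|[|n]] // x w w' _; elim: n x w w' => [|n IH] x w w'.
  have len e : length (sigma (n := 2) ord0 ^+ e) = e.
    by elim: e => [|e IH]; rewrite ?length1 // expgS lengthM IH length_sigma.
  by case=> e [-> ->] [e' [/(congr1 (@length _)) + ->]]; rewrite !len => ->.
move=> [xs [ws [hx hws ->]]] [xs' [ws' [hx' hws' ->]]].
rewrite -(splitting_unique hx hx') in hws'.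
by congr word_alt; apply: Forall2_uniq hws hws'.
Qed.

Theorem proposition5p18 (n : nat) (hn : 2 <= n) (x : braid n) :
  exists w : word n,
    unique (Burckel_normal_form x) w /\ unique (Phi_normal_form x) w.
Proof.
have BP w : Burckel_normal_form x w -> Phi_normal_form x w.
  by case=> <-; apply: Burckel_Phi.
have [w bw] := Burckel_exists x; exists w.
have uP v : Phi_normal_form x v -> w = v.
  by apply: Phi_normal_form_unique => //; apply: BP.
by split; split=> //; [move=> v /BP/uP|exact: BP].
Qed.
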